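(* Let $C=(C_n)_{n\ge1}$ be a strong divisibility sequence and let $p$ be an ideal prime for $C$ (with associated integer $s(p)\ge1$). Then for any integer $n\ge0$ with standard base-$p$ representation $n=n_\ell\cdots n_1n_0$ (digits $n_i\in\{0,\dots,p-1\}$), and for any integer $0\le r<\alpha(p)$, \[ T_{p,C}(\alpha(p)\cdot n+r,x)=\begin{bmatrix} r+1 & (\alpha(p)-r-1)x^{s(p)-1}\end{bmatrix} M_p(n_0)M_p(n_1)\cdots M_p(n_\ell)\begin{bmatrix}1\\0\end{bmatrix}. \]
   Context: A strong divisibility sequence is a sequence $C=C_1,C_2,\dots$ of nonzero integers with $\gcd(C_n,C_m)=C_{\gcd(n,m)}$ for all positive $n,m$. The $C$-orial is $0!_C=1$, $n!_C=C_nC_{n-1}\cdots C_1$ for $n\ge1$, and the $C$-nomial coefficient is $\binom{n}{m}_C=\frac{n!_C}{m!_C(n-m)!_C}$ for $0\le m\le n$ (an integer). For a prime $p$, $\nu_p$ is the $p$-adic valuation, and $T_{p,C}(n,x)=\sum_{m=0}^n x^{\nu_p(\binom{n}{m}_C)}$. The rank of apparition $\alpha(m)$ is the least index $j\ge1$ with $m\mid C_j$ (if it exists). When $\alpha(p^k)$ exists for all $k\ge1$, set $a_1(p)=\alpha(p)$ and $a_k(p)=\alpha(p^k)/\alpha(p^{k-1})$ for $k\ge2$. The prime $p$ is ideal for $C$ if $\alpha(p^k)$ exists for all $k\ge1$ and there is an integer $s(p)\ge1$ with $a_k(p)=1$ for $2\le k\le s(p)$ and $a_k(p)=p$ for $k>s(p)$.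 For $d\in\{0,1,\dots,p-1\}$, $M_p(d)=\begin{bmatrix} d+1 & p-d-1\\ dx & (p-d)x\end{bmatrix}$. *)

(* Defs.v *)
From HB Require Import structures.
From mathcomp Require Import all_boot all_order all_algebra.
From mathcomp Require Import boolp.

Set Implicit Arguments.
Unset Strict Implicit.
Unset Printing Implicit Defensive.

Import GRing.Theory.
Local Open Scope ring_scope.

(* A sequence C_1, C_2, ... is a function nat -> int; its value at 0 is never
   constrained or used. *)
Definition strong_divisibility (C : nat -> int) : Prop :=
  (forall n, (0 < n)%N -> C n != 0) /\
  (forall n m, (0 < n)%N -> (0 < m)%N -> gcdz (C n) (C m) = C (gcdn n m)).

Definition Corial (C : nat -> int) (n : nat) : int :=
  \prod_(1 <= i < n.+1) C i.

(* The division is exact when C is a strong divisibility sequence and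
   m <= n. *)
Definition Cnomial (C : nat -> int) (n m : nat) : int :=
  (Corial C n %/ (Corial C m * Corial C (n - m)))%Z.

Definition padic_val (p : nat) (z : int) : nat := logn p `|z|%N.

Definition Tpoly (p : nat) (C : nat -> int) (n : nat) : {poly int} :=
  \sum_(m < n.+1) 'X^(padic_val p (Cnomial C n m)).

Definition has_apparition (C : nat -> int) (m : nat) : Prop :=
  exists j, (0 < j)%N && (m%:Z %| C j)%Z.

(* Takes the junk value 0 when m divides no C_j with j >= 1. *)
Definition apparition (C : nat -> int) (m : nat) : nat :=
  if pselect (has_apparition C m) is left h then ex_minn h else 0%N.

(* The quotients a_k(p), a priori rational; only used for k >= 1. *)
Definition apparition_ratio (C : nat -> int) (p k : nat) : rat :=
  if k == 1%N then (apparition C p)%:R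
  else (apparition C (p ^ k))%:R / (apparition C (p ^ k.-1))%:R.

(* p is an ideal prime for C with associated integer s = s(p). *)
Definition ideal_with (C : nat -> int) (p s : nat) : Prop :=
  [/\ prime p,
      forall k, (1 <= k)%N -> has_apparition C (p ^ k),
      (1 <= s)%N,
      forall k, (2 <= k <= s)%N -> apparition_ratio C p k = 1
    & forall k, (s < k)%N -> apparition_ratio C p k = p%:R].

(* n = d_l ... d_1 d_0 in base p, without superfluous leading zeros; 0 is
   represented by the single digit 0. *)
Definition base_repr (p n l : nat) (d : nat -> nat) : Prop :=
  [/\ forall i, (i <= l)%N -> (d i < p)%N,
      n = (\sum_(i < l.+1) d i * p ^ i)%N
    & (0 < l)%N -> d l != 0%N].

Definition mx22 (R : Type) (a b c d : R) : 'M[R]_2 :=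
  \matrix_(i < 2, j < 2)
    if i == 0 then (if j == 0 then a else b) else (if j == 0 then c else d).

Definition row2 (R : Type) (a b : R) : 'rV[R]_2 :=
  \row_(j < 2) if j == 0 then a else b.

Definition col2 (R : Type) (a b : R) : 'cV[R]_2 :=
  \col_(i < 2) if i == 0 then a else b.

Definition Mp (p d : nat) : 'M[{poly int}]_2 :=
  mx22 (d%:R + 1)     (p%:R - d%:R - 1)
       (d%:R * 'X)    ((p%:R - d%:R) * 'X).

(* Main.v *)
(** Write g for the p-adic valuation of n!.  An index i is divisible by
    a = alpha(p) exactly when p divides C_i, and then
    nu_p(C_i) = s + nu_p(i/a); hence nu_p(n!_C) = s * (n/a) + g(n/a).  The same
    formula with (a, s) = (p, 1) is Legendre's recursion for g itself.  Splitting
    the index m = a j + t of T(a n + r) according to whether t <= r (no carry) or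
    t > r (a carry) gives T(a n + r) = (r+1) T_g(n) + (a-r-1) x^(s-1) V(n), where
    V(n) = x^(1+nu_p(n)) T_g(n-1).  Using this for (p, 1) yields the recursion
    of the vector (T_g, V) under appending a digit, which is the matrix M_p. *)
Require Import Defs.
From HB Require Import structures.
From mathcomp Require Import all_boot all_order all_algebra.
From mathcomp Require Import boolp.
From mathcomp Require Import zify ring.

Set Implicit Arguments.
Unset Strict Implicit.
Unset Printing Implicit Defensive.

Import GRing.Theory.
Local Open Scope ring_scope.

(** * Integrality of the C-nomial coefficients and their valuations *)

Lemma CorialS (C : nat -> int) (n : nat) :
  Corial C n.+1 = Corial C n * C n.+1.
Proof. by rewrite /Corial big_nat_recr. Qed.

Lemma Corial0 (C : nat -> int) : Corial C 0 = 1.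
Proof. by rewrite /Corial big_nil. Qed.

Lemma Corial_neq0 (C : nat -> int) (n : nat) :
  strong_divisibility C -> Corial C n != 0.
Proof.
move=> [C0 _]; elim: n => [|n IHn]; first by rewrite Corial0.
by rewrite CorialS mulf_neq0 ?C0.
Qed.

Lemma strong_divisibility_dvd (C : nat -> int) (m n : nat) :
  strong_divisibility C -> (0 < m)%N -> (0 < n)%N -> (m %| n)%N ->
  (C m %| C n)%Z.
Proof.
move=> [_ Cgcd] m0 n0 /gcdn_idPl mn.
by rewrite -[C m]/(C m) -[in C m]mn -Cgcd // dvdz_gcdr.
Qed.

(* Bezout for C_m and C_(n-m), whose gcd divides C_n, replaces the Pascal rule. *)
Lemma Corial_dvd (C : nat -> int) (m n : nat) :
  strong_divisibility C -> (Corial C m * Corial C n %| Corial C (m + n))%Z.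
Proof.
move=> hC; move: {2}(m + n)%N (erefl (m + n)%N) => k.
elim: k m n => [|k IHk] [|m] [|n] // e;
  rewrite ?addn0 ?add0n ?Corial0 ?mul1r ?mulr1 ?dvdzz //.
have [eAk eBk] : (m + n.+1 = k /\ m.+1 + n = k)%N by lia.
have /dvdzP[A eA] := IHk m n.+1 eAk.
have /dvdzP[B eB] := IHk m.+1 n eBk.
have [u [v euv]] := Bezoutz (C m.+1) (C n.+1).
have g0 : (0 < gcdn m.+1 n.+1)%N by rewrite gcdn_gt0.
have [C0 Cgcd] := hC; rewrite Cgcd // in euv.
have /dvdzP[c ec] : (C (gcdn m.+1 n.+1) %| C (m.+1 + n.+1)%N)%Z.
  by apply: strong_divisibility_dvd; rewrite // dvdn_add ?dvdn_gcdl ?dvdn_gcdr.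
(* With N the C-orial of m+n+1, [C m.+1 * N] is [A] times the divisor and [C n.+1 * N] is [B] times
   it; the last factor C_(m+n+2) is [c] times the Bezout combination. *)
apply/dvdzP; exists (c * (u * A + v * B)).
apply: (mulfI (C0 _ g0)).
rewrite addSn addnS in ec *; rewrite CorialS ec.
rewrite addnS in eA; rewrite addSn in eB.
move: (Corial C (m + n).+1) eA eB => N; rewrite !CorialS => eA eB.
transitivity (c * (u * C m.+1 + v * C n.+1) * C (gcdn m.+1 n.+1) * N).
  by rewrite euv; ring.
transitivity (c * C (gcdn m.+1 n.+1) * (u * C m.+1 * N + v * C n.+1 * N)).
  by ring.
by rewrite {1}eA eB; ring.
Qed.

Lemma padic_valM (p : nat) (x y : int) :
  x != 0 -> y != 0 -> padic_val p (x * y) = (padic_val p x + padic_val p y)%N.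
Proof. by move=> x0 y0; rewrite /padic_val abszM lognM ?absz_gt0. Qed.

Lemma padic_val_Cnomial (p : nat) (C : nat -> int) (n m : nat) :
  strong_divisibility C -> (m <= n)%N ->
  padic_val p (Cnomial C n m) =
    (padic_val p (Corial C n) - padic_val p (Corial C m)
       - padic_val p (Corial C (n - m)))%N.
Proof.
move=> hC mn; have := Corial_dvd m (n - m) hC; rewrite subnKC // => /divzK.
rewrite -/(Cnomial C n m) => e.
have : Cnomial C n m * (Corial C m * Corial C (n - m)) != 0.
  by rewrite e Corial_neq0.
rewrite mulf_eq0 negb_or => /andP[b0 _].
by rewrite -e !padic_valM ?mulf_neq0 ?Corial_neq0 //; lia.
Qed.

(** * Ranks of apparition and valuations of the terms *)

Lemma apparition_spec (C : nat -> int) (m : nat) : has_apparition C m ->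
  [/\ (0 < apparition C m)%N, (m%:Z %| C (apparition C m))%Z
    & forall j, (0 < j)%N -> (m%:Z %| C j)%Z -> (apparition C m <= j)%N].
Proof.
move=> h; rewrite /apparition; case: pselect => // h'.
case: ex_minnP => j /andP[j0 mj] jmin; split=> // i i0 mi.
by apply: jmin; rewrite i0.
Qed.

(** If m divides C_n, it divides gcd(C_n, C_a) = C_gcd(n,a) with a = alpha(m), and minimality of a
    forces gcd(n,a) = a. *)
Lemma apparition_dvd (C : nat -> int) (m n : nat) :
  strong_divisibility C -> has_apparition C m -> (0 < n)%N ->
  (m%:Z %| C n)%Z = (apparition C m %| n)%N.
Proof.
move=> hC /apparition_spec[a0 ma amin] n0; apply/idP/idP => [mn|an].
  have g0 : (0 < gcdn n (apparition C m))%N by rewrite gcdn_gt0 n0.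
  have /amin : (m%:Z %| C (gcdn n (apparition C m)))%Z.
    by case: hC => _ <- //; rewrite dvdz_gcd mn.
  move=> /(_ g0) ag; apply/gcdn_idPr/eqP; rewrite eqn_leq ag andbT.
  by apply: dvdn_leq => //; rewrite dvdn_gcdr.
by apply: dvdz_trans ma _; apply: strong_divisibility_dvd.
Qed.

(** The ratios telescope; the truncated [k - s] stays 0 while they equal 1, then counts the factors
    p. *)
Lemma ideal_apparition (C : nat -> int) (p s k : nat) : ideal_with C p s ->
  (0 < k)%N -> apparition C (p ^ k) = (apparition C p * p ^ (k - s))%N.
Proof.
move=> [pp hap s1 hs hbig]; elim: k => // -[|k] IHk _.
  by rewrite expn1 (_ : 1 - s = 0)%N ?muln1 //; lia.
have [a0 _ _] := apparition_spec (hap k.+1 isT).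
(* Existence of the rank excludes the junk value 0, so the rational denominator can be cleared. *)
have a0' : (apparition C (p ^ k.+1))%:R != 0 :> rat by rewrite Num.Theory.pnatr_eq0 -lt0n.
have cast (x y : nat) : (x%:R = y%:R :> rat) -> x = y.
  by move/eqP; rewrite Num.Theory.eqr_nat => /eqP.
have [ks|sk] := leqP k.+2 s.
  have := hs k.+2 ks; rewrite /apparition_ratio /= => /divr1_eq/cast ->.
  rewrite IHk //; congr (_ * p ^ _)%N; lia.
have := hbig k.+2 sk; rewrite /apparition_ratio /= => /(canRL (mulfVK a0')).
rewrite -natrM => /cast ->.
by rewrite IHk // mulnCA -expnS; congr (_ * p ^ _)%N; lia.
Qed.

(** For k >= 1, p^k divides C_n exactly when alpha(p) p^(k-s) divides n; these thresholds determine
    the valuation. *)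
Lemma padic_val_ideal (C : nat -> int) (p s n : nat) :
  strong_divisibility C -> ideal_with C p s -> (0 < n)%N ->
  padic_val p (C n) =
    if (apparition C p %| n)%N then (s + logn p (n %/ apparition C p))%N else 0%N.
Proof.
move=> hC hp n0; have [pp hap s1 _ _] := hp.
have hap1 : has_apparition C p by rewrite -[p]expn1; apply: hap.
have [a0 _ _] := apparition_spec hap1.
have Cn0 : (0 < `|C n|)%N by rewrite absz_gt0; case: hC => ->.
have val_ge k : (0 < k)%N ->
    (k <= padic_val p (C n))%N = (apparition C p * p ^ (k - s) %| n)%N.
  move=> k0; rewrite /padic_val -pfactor_dvdn // -(ideal_apparition hp k0).
  by rewrite -(apparition_dvd hC (hap k k0) n0).
case: ifPn => an; last first.
  apply/eqP; rewrite -leqn0 leqNgt val_ge //.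
  by rewrite (_ : 1 - s = 0)%N ?muln1 //; lia.
have q0 : (0 < n %/ apparition C p)%N by rewrite divn_gt0 // dvdn_leq.
have val_ge' k : (0 < k)%N ->
    (k <= padic_val p (C n))%N = (k <= s + logn p (n %/ apparition C p))%N.
  move=> k0; rewrite val_ge // -[in LHS](divnK an) mulnC dvdn_pmul2r //.
  by rewrite pfactor_dvdn // leq_subLR.
(* Each side is used as the threshold k for the other. Positivity of k comes from s >= 1 in one
   direction; in the other, valuation 0 is trivial. *)
apply/eqP; rewrite eqn_leq; apply/andP; split; last by rewrite val_ge' //; lia.
by case: (posnP (padic_val p (C n))) => [-> //|v0]; rewrite -val_ge'.
Qed.

(** * Legendre-type formulas for C-orials and factorials *)

Lemma sum_val_multiples (p a s n : nat) (v : nat -> nat) : (0 < a)%N ->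
  (forall i, (0 < i)%N ->
     v i = if (a %| i)%N then (s + logn p (i %/ a))%N else 0%N) ->
  (\sum_(1 <= i < n.+1) v i = s * (n %/ a) + logn p (n %/ a)`!)%N.
Proof.
move=> a0 hv; elim: n => [|n IHn]; first by rewrite big_nil div0n muln0 logn1.
rewrite big_nat_recr //= IHn hv // divnS //.
(* The quotient by [a] grows only when [a] divides n+1; the new term then brings [s] and the
   valuation of the factor appended to the factorial. *)
case: (a %| n.+1)%N => /=; last by rewrite add0n addn0.
by rewrite add1n factS lognM ?fact_gt0 // mulnS; lia.
Qed.

Lemma padic_val_Corial (C : nat -> int) (p s n : nat) :
  strong_divisibility C -> ideal_with C p s ->
  padic_val p (Corial C n) =
    (s * (n %/ apparition C p) + logn p (n %/ apparition C p)`!)%N.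
Proof.
move=> hC hp; have [pp hap _ _ _] := hp.
have /apparition_spec[a0 _ _] : has_apparition C p by rewrite -[p]expn1; apply: hap.
rewrite -(sum_val_multiples n a0 (fun i => padic_val_ideal hC hp (n := i))).
elim: n => [|n IHn]; first by rewrite Corial0 big_nil /padic_val logn1.
by rewrite CorialS big_nat_recr //= padic_valM ?IHn ?Corial_neq0 //; case: hC => ->.
Qed.

(** The factor [1] is kept to match the shape required of [F] in [binpoly_digit]. *)
Lemma logn_fact_div (p n : nat) : prime p ->
  logn p n`! = (1 * (n %/ p) + logn p (n %/ p)`!)%N.
Proof.
move=> pp; rewrite -(@sum_val_multiples p p 1 n (logn p)) ?prime_gt0 //.
  elim: n => [|n IHn]; first by rewrite big_nil logn1.
  by rewrite factS big_nat_recr //= lognM ?fact_gt0 // IHn addnC.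
move=> i i0; case: ifPn => pi; last by rewrite lognE pp i0 (negPf pi).
by rewrite lognE pp i0 pi.
Qed.

(** * Digit recursions for the generating polynomials *)

Definition binpoly (F : nat -> nat) (n : nat) : {poly int} :=
  \sum_(m < n.+1) 'X^(F n - F m - F (n - m)%N).

(* Second coordinate of the digit recursion: V(n) above, with V(0) = 0 because
   n = 0 leaves no room for a carry. *)
Definition carrypoly (p n : nat) : {poly int} :=
  if n is n'.+1
  then 'X^((logn p n).+1) * binpoly (fun k => logn p k`!) n' else 0.

(** With k = r+1 and k+b = a, the range is m <= a n + r: its last block is incomplete, so residues
    from k on occur once less often. *)
Lemma sum_residues (V : nmodType) (k b n : nat) (h : nat -> V) :
  \sum_(m < (k + b) * n + k) h m =
    \sum_(j < n.+1) \sum_(t < k) h ((k + b) * j + t)%N +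
    \sum_(j < n) \sum_(t < b) h ((k + b) * j + (k + t))%N.
Proof.
elim: n => [|n IHn].
  by rewrite muln0 big_ord0 big_ord1 addr0; apply: eq_bigr => i _; rewrite muln0.
rewrite (_ : (k + b) * n.+1 + k = ((k + b) * n + k) + (b + k))%N; last by lia.
rewrite big_split_ord /= IHn big_split_ord /=.
rewrite [in RHS]big_ord_recr /= [X in _ = _ + X]big_ord_recr /= addrACA.
congr (_ + _); rewrite addrC; congr (_ + _); apply: eq_bigr => t _;
  by congr h; lia.
Qed.

Lemma divn_mulD (a j t : nat) : (t < a)%N -> ((a * j + t) %/ a = j)%N.
Proof.
by move=> ta; rewrite mulnC divnMDl ?divn_small ?addn0 //; apply: leq_ltn_trans ta.
Qed.

(** Keeps the natural subtractions in the exponents from truncating. *)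
Lemma logn_fact_super (p j n : nat) : (j <= n)%N ->
  (logn p j`! + logn p (n - j)`! <= logn p n`!)%N.
Proof.
move=> jn; rewrite -(bin_fact jn) !lognM ?muln_gt0 ?fact_gt0 ?bin_gt0 //.
exact: leq_addl.
Qed.

Lemma binpoly_digit (p a s n r : nat) (F : nat -> nat) :
  (0 < s)%N -> (r < a)%N ->
  (forall k, F k = s * (k %/ a) + logn p (k %/ a)`!)%N ->
  binpoly F (a * n + r) =
    (r%:R + 1) * binpoly (fun k => logn p k`!) n +
    (a%:R - r%:R - 1) * 'X^(s - 1) * carrypoly p n.
Proof.
move=> s0 ra; have {ra}[b ->] : exists b, a = (r.+1 + b)%N.
  by exists (a - r.+1)%N; rewrite subnKC.
set a' := (r.+1 + b)%N => hF.
rewrite /binpoly -addnS.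
rewrite (@sum_residues _ r.+1 b n
  (fun m => 'X^(F (a' * n + r)%N - F m - F (a' * n + r - m)%N))) -/a'.
congr (_ + _).
  rewrite mulr_sumr; apply: eq_bigr => -[j jn] _ /=.
  (* No carry: the quotients j and n-j add up to n, so the multiples of [s] cancel and the exponent
     is independent of t. *)
  transitivity (\sum_(t < r.+1)
      ('X^(logn p n`! - logn p j`! - logn p (n - j)`!) : {poly int})).
    apply: eq_bigr => -[t tr] _ /=; congr ('X^_); rewrite !hF.
    have -> : (a' * n + r - (a' * j + t) = a' * (n - j) + (r - t))%N.
      by rewrite mulnBr; have := leq_mul (leqnn a') (ltnSE jn); lia.
    rewrite !divn_mulD; [| rewrite /a'; lia ..].
    by rewrite mulnBr; have := leq_mul (leqnn s) (ltnSE jn); lia.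
  by rewrite sumr_const card_ord -[LHS]mulr_natl -natr1.
case: n => [|n]; first by rewrite big_ord0 mulr0.
rewrite /carrypoly /binpoly mulrA mulr_sumr; apply: eq_bigr => -[j jn] _ /=.
(* Carry: the quotients j and n-j add up to one less than the top quotient n+1, leaving one [s] and
   the valuation of n+1. *)
transitivity (\sum_(t < b)
    ('X^(s + logn p n.+1 + (logn p n`! - logn p j`! - logn p (n - j)`!)) : {poly int})).
  apply: eq_bigr => -[t tb] _ /=; congr ('X^_); rewrite !hF.
  have -> : (a' * n.+1 + r - (a' * j + (r.+1 + t)) = a' * (n - j) + (a' - 1 - t))%N.
    by rewrite mulnBr mulnS; have := leq_mul (leqnn a') (ltnSE jn); rewrite /a'; lia.
  rewrite !divn_mulD; [| rewrite /a'; lia ..].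
  rewrite factS lognM ?fact_gt0 // mulnBr mulnS.
  by have := leq_mul (leqnn s) (ltnSE jn); have := logn_fact_super p (ltnSE jn); lia.
rewrite sumr_const card_ord -[LHS]mulr_natl.
have -> : (s + logn p n.+1 = (s - 1) + (logn p n.+1).+1)%N by lia.
by rewrite !exprD /a' natrD -natr1; ring.
Qed.

(** If d > 0, then pn+d is prime to p and its predecessor ends in d-1. If d = 0 and n > 0, the
    predecessor ends in p-1, which kills the carry term of [binpoly_digit], and the valuation of pn
    exceeds that of n by 1. *)
Lemma carrypoly_digit (p n d : nat) : prime p -> (d < p)%N ->
  carrypoly p (p * n + d) =
    d%:R * 'X * binpoly (fun k => logn p k`!) n +
    (p%:R - d%:R) * 'X * carrypoly p n.
Proof.
move=> pp; have p0 := prime_gt0 pp.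
have hg k := @logn_fact_div p k pp.
case: d => [_|d dp].
  case: n => [|n]; first by rewrite muln0 addn0 /=; ring.
  have e : (p * n.+1 + 0 = (p * n + p.-1).+1)%N by rewrite mulnS; lia.
  rewrite e /carrypoly -e addn0 lognM // (logn_prime p pp) eqxx add1n.
  rewrite (@binpoly_digit p p 1 n p.-1 _ isT _ hg); last by rewrite prednK.
  by rewrite -subn1 natrB // !exprS; ring.
rewrite addnS /carrypoly -addnS (@binpoly_digit p p 1 n d _ isT _ hg) ?(ltnW dp) //.
have -> : logn p (p * n + d.+1) = 0%N.
  apply/eqP; rewrite -leqn0 leqNgt -pfactor_dvdn ?addnS // expn1 -addnS.
  by rewrite dvdn_addr ?dvdn_mulr //; apply/negP => /dvdn_leq; lia.
rewrite subnn expr0 expr1 -[d.+1]addn1 natrD -/(carrypoly p n); ring.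
Qed.

(** * Matrix form of the recursions *)

Lemma mul_mx22_col2 (R : comPzRingType) (a b c d u v : R) :
  mx22 a b c d *m col2 u v = col2 (a * u + b * v) (c * u + d * v).
Proof.
by apply/matrixP => i j; rewrite !mxE !big_ord_recl big_ord0 !mxE /= addr0; case: ifP.
Qed.

Lemma mul_row2_col2 (R : comPzRingType) (a b u v : R) :
  (row2 a b *m col2 u v) 0 0 = a * u + b * v.
Proof. by rewrite !mxE !big_ord_recl big_ord0 !mxE /= addr0. Qed.

(** Induction peels off the leftmost matrix, which belongs to the lowest digit; the empty product
    encodes T_g(0) = 1 and V(0) = 0. *)
Lemma prod_Mp (p l : nat) (d : nat -> nat) : prime p ->
  (forall i, (i < l)%N -> (d i < p)%N) ->
  (\prod_(i < l) Mp p (d i)) *m col2 1 0 =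
    col2 (binpoly (fun k => logn p k`!) (\sum_(i < l) d i * p ^ i))
         (carrypoly p (\sum_(i < l) d i * p ^ i)).
Proof.
move=> pp; elim: l d => [|l IHl] d dp.
  rewrite !big_ord0 /= mul1mx /binpoly big_ord1 /=.
  by rewrite fact0 logn1 expr0.
rewrite !big_ord_recl /= -mulmxE -mulmxA.
rewrite (IHl (fun i => d i.+1)) => [|i il]; last exact: dp.
rewrite /Mp mul_mx22_col2 expn0 muln1.
set n := (\sum_(i < l) d i.+1 * p ^ i)%N.
have -> : (\sum_(i < l) d (bump 0 i) * p ^ bump 0 i = p * n)%N.
  by rewrite /n big_distrr /=; apply: eq_bigr => i _; rewrite [RHS]mulnCA -expnS.
have d0 : (d 0 < p)%N by apply: dp.
rewrite addnC carrypoly_digit //.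
rewrite (@binpoly_digit p p 1 n (d 0) _ isT d0 (fun k => logn_fact_div k pp)).
by rewrite subnn expr0 mulr1.
Qed.

Theorem theorem1p1 (C : nat -> int) (p s : nat)
    (hC : strong_divisibility C) (hp : ideal_with C p s)
    (n l : nat) (d : nat -> nat) (hn : base_repr p n l d)
    (r : nat) (hr : (r < apparition C p)%N) :
  Tpoly p C (apparition C p * n + r) =
    (row2 (r%:R + 1) (((apparition C p)%:R - r%:R - 1) * 'X^(s - 1))
       *m (\prod_(i < l.+1) Mp p (d i))
       *m col2 1 0) 0 0.
Proof.
have [pp _ s1 _ _] := hp; have [dp -> _] := hn.
rewrite -mulmxA prod_Mp // mul_row2_col2.
(* The row vector is the same digit step with modulus alpha(p) and weight s, applied to the
   valuations of C-orials. *)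
rewrite -(binpoly_digit _ s1 hr (fun k => padic_val_Corial k hC hp)).
by apply: eq_bigr => m _; rewrite padic_val_Cnomial // -ltnS.
Qed.
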